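(* Let $\alpha,\beta>-1$ be real numbers and let $n\ge 0$ be an integer. For every integer $i$ with $0\le i\le n-3$, the dual Bernstein polynomials of degree $n$ satisfy the following identity of polynomials in $x$: $$w_0(i)D^n_i(x;\alpha,\beta)+w_1(i)D^n_{i+1}(x;\alpha,\beta)+w_2(i)D^n_{i+2}(x;\alpha,\beta)+w_3(i)D^n_{i+3}(x;\alpha,\beta)=0,$$ where $$w_0(i):=(x-1)(i+1)(n-i+\alpha-1)_2,$$ $$w_1(i):=(n-i+\alpha-1)\big[x(n-i)(n-i+\alpha)+2(x-1)(i+2)(i+\beta+2)\big],$$ $$w_2(i):=(i+\beta+2)\big[(x-1)(i+3)(i+\beta+3)+2x(n-i-1)(n-i+\alpha-1)\big],$$ $$w_3(i):=x(n-i-2)(i+\beta+2)_2,$$ and $(c)_2:=c(c+1)$.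
   Context: Inner product: $\langle f,g\rangle_{\alpha,\beta}:=\int_0^1(1-x)^\alpha x^\beta f(x)g(x)\,dx$, with $\alpha,\beta>-1$. Bernstein basis polynomials: $B^n_i(x):=\binom{n}{i}x^i(1-x)^{n-i}$, $0\le i\le n$. Dual Bernstein polynomials of degree $n$: the unique polynomials $D^n_0(x;\alpha,\beta),\ldots,D^n_n(x;\alpha,\beta)$ of degree at most $n$ such that $\langle B^n_i,D^n_j(\cdot;\alpha,\beta)\rangle_{\alpha,\beta}=\delta_{ij}$ for $i,j=0,1,\ldots,n$. *)

(* Defs.v *)
From mathcomp Require Import all_boot all_order all_algebra.
From mathcomp Require Import all_classical all_reals all_analysis.

Set Implicit Arguments.
Unset Strict Implicit.
Unset Printing Implicit Defensive.

Import Order.TTheory GRing.Theory Num.Theory.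
Import numFieldNormedType.Exports.

Local Open Scope classical_set_scope.
Local Open Scope ring_scope.

(* At the endpoints the library's total [powR] may differ from the usual
   (possibly infinite) value of the weight, but {0, 1} is Lebesgue-null. *)
Definition jacobi_ip (R : realType) (alpha beta : R) (f g : R -> R) : R :=
  \int[@lebesgue_measure R]_(x in `[0%R, 1%R])
    ((1 - x) `^ alpha * x `^ beta * f x * g x).

Definition bernstein (R : realType) (n i : nat) : {poly R} :=
  'C(n, i)%:R *: ('X^i * (1 - 'X) ^+ (n - i)).

(* The family is indexed by [nat]; only [D 0], ..., [D n] are constrained. *)
Definition is_dual_bernstein (R : realType) (n : nat) (alpha beta : R)
    (D : nat -> {poly R}) : Prop :=
  (forall j : nat, (j <= n)%N -> (size (D j) <= n.+1)%N) /\
  (forall i j : nat, (i <= n)%N -> (j <= n)%N ->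
    jacobi_ip alpha beta (horner (bernstein R n i)) (horner (D j))
      = (i == j)%:R).

Definition poch2 (R : realType) (c : R) : R := c * (c + 1).

(* In the weights, [n - i] is the subtraction of the real numbers [n%:R] and
   [i%:R]. *)
Definition w0 (R : realType) (n : nat) (alpha : R) (i : nat) : {poly R} :=
  ((i%:R + 1) * poch2 (n%:R - i%:R + alpha - 1)) *: ('X - 1).

Definition w1 (R : realType) (n : nat) (alpha beta : R) (i : nat) : {poly R} :=
  (n%:R - i%:R + alpha - 1) *:
    (((n%:R - i%:R) * (n%:R - i%:R + alpha)) *: 'X
     + (2 * (i%:R + 2) * (i%:R + beta + 2)) *: ('X - 1)).

Definition w2 (R : realType) (n : nat) (alpha beta : R) (i : nat) : {poly R} :=
  (i%:R + beta + 2) *: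
    (((i%:R + 3) * (i%:R + beta + 3)) *: ('X - 1)
     + (2 * (n%:R - i%:R - 1) * (n%:R - i%:R + alpha - 1)) *: 'X).

Definition w3 (R : realType) (n : nat) (beta : R) (i : nat) : {poly R} :=
  ((n%:R - i%:R - 2) * poch2 (i%:R + beta + 2)) *: 'X.

(* Main.v *)
Require Import Defs.
From HB Require Import structures.
From mathcomp Require Import all_boot all_order all_algebra.
From mathcomp Require Import all_classical all_reals all_analysis.
From mathcomp Require Import measurable_realfun ring lra.

(** Write L(p) for the integral of (1-x)^alpha x^beta p(x) over [0,1].
Multiplication by 1-x or by x carries a Bernstein polynomial of degree n-1
to a multiple of one of degree n, so biorthogonality makes the combination
E_j = (j+1) (x-1) D_j + (n-j) x D_{j+1} orthogonal to all polynomials of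
degree less than n [dual_pair_orth].  With N = n-i+alpha and b = i+beta+2 the
left-hand side P of the recurrence is exactly
N (N-1) E_i + 2 (N-1) b E_{i+1} + b (b+1) E_{i+2}; hence P has degree at most
n+1 and is orthogonal to degree less than n.  Once P(0) = P(1) = 0 is known,
P = x(1-x)q with deg q < n up to sign, so L(x(1-x)q^2) = 0, and definiteness
of L gives P = 0 [orth_endpoints_eq0].

The values of P at the endpoints come from a two-term recurrence for
D_j(0) and its mirror image for D_j(1).  Let m_j = L(x^(j+1) (1-x)^(n-j)) and
let g be the sum of (-1)^j B_j / m_j.  By the beta function recursion,
L(x^(j+1+k) (1-x)^(n-j)) / m_j is a polynomial of degree k in j, so that for
k < n the number L(g x^(k+1)) is an n-th finite difference of a polynomial of
degree less than n, that is, zero.  So pairing with g is evaluation at 0 up to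
the factor L(g) [endpoint_poly_eval], and pairing D_j with g gives
D_j(0) L(g) = (-1)^j / m_j.  The ratio m_j / m_{j+1} is given by the beta
recursion again.

About the integral only three facts enter: it is linear, it satisfies the beta
recursion, and it is definite on polynomials nonnegative on (0,1); these are
collected in [jacobi_functional].  Linearity needs integrability of the
weight, whose exponents may be negative.  Both integrability and the beta
recursion follow from a fundamental theorem of calculus on the open interval
for nonnegative derivatives [ge0_FTC_oo]. *)

Set Implicit Arguments.
Unset Strict Implicit.
Unset Printing Implicit Defensive.

Import Order.TTheory GRing.Theory Num.Theory.
Local Open Scope ring_scope.

(** * Alternating binomial sums *)

Definition rising (R : comPzRingType) (c : R) (k : nat) : R :=
  \prod_(l < k) (c + l%:R).

Lemma risingS (R : comPzRingType) (c : R) (k : nat) :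
  rising c k.+1 = c * rising (c + 1) k.
Proof.
rewrite /rising big_ord_recl addr0; congr (_ * _); apply: eq_bigr => l _.
by rewrite lift0 -natr1; ring.
Qed.

Lemma risingSr (R : comPzRingType) (c : R) (k : nat) :
  rising c k.+1 = rising c k * (c + k%:R).
Proof. by rewrite /rising big_ord_recr. Qed.

Lemma rising_gt0 (R : numDomainType) (c : R) (k : nat) :
  0 < c -> 0 < rising c k.
Proof. by move=> c0; apply: prodr_gt0 => l _; rewrite ltr_wpDr. Qed.

Lemma rising_diff (R : comPzRingType) (c : R) (k : nat) :
  rising (c + 1) k.+1 - rising c k.+1 = k.+1%:R * rising (c + 1) k.
Proof. by rewrite risingSr risingS -natr1; ring. Qed.

(** Pascal's rule turns an alternating sum of order n+1 into one of order n
for the first difference, which is what drives the induction below. *)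
Lemma alternating_binomial_pascal (R : comPzRingType) (n : nat) (f : nat -> R) :
  \sum_(j < n.+2) (-1) ^+ j * 'C(n.+1, j)%:R * f j =
  \sum_(j < n.+1) (-1) ^+ j * 'C(n, j)%:R * (f j - f j.+1).
Proof.
have -> : \sum_(j < n.+1) (-1) ^+ j * 'C(n, j)%:R * (f j - f j.+1) =
    \sum_(j < n.+2) (-1) ^+ j * 'C(n, j)%:R * f j
    - \sum_(j < n.+1) (-1) ^+ j * 'C(n, j)%:R * f j.+1.
  rewrite [X in _ = X - _]big_ord_recr /= bin_small // mulr0 mul0r addr0 -sumrB.
  by apply: eq_bigr => j _; rewrite mulrBr.
rewrite big_ord_recl [in RHS]big_ord_recl !bin0 -addrA -sumrB.
congr (_ + _); apply: eq_bigr => j _.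
by rewrite lift0 binS natrD exprS; ring.
Qed.

(** An n-th finite difference kills polynomials of degree below n; rising
factorials are convenient since differencing maps them to each other. *)
Lemma alternating_binomial_rising (R : comPzRingType) (n k : nat) (c : R) :
  (k < n)%N ->
  \sum_(j < n.+1) (-1) ^+ j * 'C(n, j)%:R * rising (c + j%:R) k = 0.
Proof.
elim: n k c => // n IHn [|k] c ltkn.
  rewrite (alternating_binomial_pascal n (fun j => rising (c + j%:R) 0)).
  by apply: big1 => j _; rewrite /rising !big_ord0 subrr mulr0.
rewrite (alternating_binomial_pascal n (fun j => rising (c + j%:R) k.+1)).
transitivity (- k.+1%:R * \sum_(j < n.+1)
    (-1) ^+ j * 'C(n, j)%:R * rising (c + 1 + j%:R) k).
  rewrite mulr_sumr; apply: eq_bigr => j _.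
  have -> : c + j.+1%:R = c + j%:R + 1 :> R by rewrite -natr1; ring.
  by rewrite -opprB rising_diff (addrAC c 1); ring.
by rewrite IHn ?mulr0.
Qed.

(** * Polynomials in x and 1-x *)

Definition bern (R : realType) (a b : nat) : {poly R} := 'X^a * (1 - 'X) ^+ b.

Lemma bern_monomial_split (R : realType) (a b : nat) :
  bern R a b = bern R a.+1 b + bern R a b.+1.
Proof. by rewrite /bern !exprS; ring. Qed.

Lemma bernsteinE (R : realType) (n j : nat) :
  bernstein R n j = 'C(n, j)%:R *: bern R j (n - j).
Proof. by []. Qed.

Lemma size_split0 (R : realType) (n : nat) (p : {poly R}) :
  (size p <= n.+1)%N ->
  exists2 q : {poly R}, (size q <= n)%N & p = p.[0]%:P + 'X * q.
Proof.
move=> sp; have /factor_theorem[q pq] : root (p - p.[0]%:P) 0.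
  by rewrite rootE !hornerE subrr.
rewrite subr0 in pq.
exists q; last by rewrite mulrC -pq addrC subrK.
have [->|q0] := eqVneq q 0; first by rewrite size_poly0.
rewrite -ltnS -(size_mulX q0) -pq (leq_trans (size_polyD _ _)) //.
by rewrite size_polyN geq_max sp (leq_trans (size_polyC_leq1 _)).
Qed.

(** The polynomials x^k (1-x)^(m-1-k) span those of degree below m: subtract
q(0) (1-x)^(m-1) and divide by x.  Dividing lowers m but moves a factor x onto
p, hence the induction is over all p. *)
Lemma orth_of_bern (R : realType) (L : {scalar {poly R}}) (p q : {poly R})
    (m : nat) : (size q <= m)%N ->
  (forall k, (k < m)%N -> L (bern R k (m.-1 - k) * p) = 0) -> L (q * p) = 0.
Proof.
elim: m p q => [|m IHm] p q sq H.
  by rewrite (size_poly_leq0P _ sq) mul0r linear0.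
have b1 : (bern R 0 m).[0] = 1 by rewrite /bern !hornerE subr0 expr1n.
have [|r sr] := @size_split0 R m (q - q.[0] *: bern R 0 m).
  rewrite (leq_trans (size_polyD _ _)) // size_polyN geq_max sq.
  rewrite (leq_trans (size_scale_leq _ _)) // /bern expr0 mul1r.
  rewrite (leq_trans (size_poly_exp_leq _ _)) //.
  by rewrite -opprB size_polyN size_XsubC mul1n.
rewrite hornerD hornerN hornerZ b1 mulr1 subrr add0r => /(canRL (subrK _)) ->.
rewrite mulrDl linearD /= -mulrA mulrCA -scalerAl linearZ /=.
have := H 0%N isT; rewrite subn0 => ->; rewrite mulr0 addr0.
apply: IHm => // k km.
have := H k.+1 km; rewrite /= -[k.+1]add1n subnDA subn1 => <-.
by congr (L _); rewrite /bern exprS; ring.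
Qed.

Lemma reflectK (R : realType) (p : {poly R}) :
  (p \Po (1 - 'X)) \Po (1 - 'X) = p.
Proof.
by rewrite -comp_polyA comp_polyB comp_polyX comp_polyC subKr comp_polyXr.
Qed.

Lemma reflect_bern (R : realType) (a b : nat) :
  bern R a b \Po (1 - 'X) = bern R b a.
Proof.
rewrite /bern comp_polyM !rmorphXn /= comp_polyB comp_polyX comp_polyC subKr.
by rewrite mulrC.
Qed.

Lemma size_reflect (R : realType) (p : {poly R}) :
  size (p \Po (1 - 'X)) = size p.
Proof.
apply: size_comp_poly2.
by rewrite -opprB size_polyN size_XsubC.
Qed.

(** * Functionals of Jacobi type *)

(** The first field is the recursion of the beta function
B(beta+1+a, alpha+1+b); the second one gives both the nonvanishing of these
values and the definiteness of the weighted inner product. *)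
Record jacobi_functional (R : realType) (alpha beta : R)
    (L : {scalar {poly R}}) : Prop := JacobiFunctional {
  jacobi_beta : forall a b : nat,
    (beta + 1 + a%:R) * L (bern R a b.+1)
      = (alpha + 1 + b%:R) * L (bern R a.+1 b);
  jacobi_definite : forall p : {poly R},
    (forall x, 0 < x < 1 -> 0 <= p.[x]) -> L p = 0 -> p = 0 }.

Definition dual_family (R : realType) (L : {scalar {poly R}}) (n : nat)
    (D : nat -> {poly R}) : Prop :=
  (forall j, (j <= n)%N -> (size (D j) <= n.+1)%N) /\
  (forall i j, (i <= n)%N -> (j <= n)%N ->
     L (bernstein R n i * D j) = (i == j)%:R).

(** * Values of the dual polynomials at the endpoints *)

Section Endpoint.
Variables (R : realType) (alpha beta : R) (L : {scalar {poly R}}).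
Hypotheses (ha : -1 < alpha) (hb : -1 < beta).
Hypothesis HL : jacobi_functional alpha beta L.

Lemma jacobi_bern_neq0 (a b : nat) : L (bern R a b) != 0.
Proof.
apply/eqP => /(jacobi_definite HL) H.
have /eqP : bern R a b = 0.
  apply: H => x /andP[x0 x1].
  by rewrite !hornerE mulr_ge0 ?exprn_ge0 ?subr_ge0 // ltW.
have h1 : 1 - 'X != 0 :> {poly R}.
  by apply/eqP => /(congr1 (horner ^~ 0)); rewrite !hornerE; lra.
by rewrite /bern mulf_eq0 !expf_eq0 polyX_eq0 (negPf h1) !andbF.
Qed.

Lemma jacobi_bernS (a b : nat) :
  (alpha + beta + 2 + (a + b)%:R) * L (bern R a.+1 b) =
  (beta + 1 + a%:R) * L (bern R a b).
Proof.
rewrite (bern_monomial_split R a b) linearD /= mulrDr (jacobi_beta HL) natrD.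
by ring.
Qed.

(** The quotient of the two values of L is a polynomial of degree k in a as
long as a + b stays fixed. *)
Lemma jacobi_bern_rising (a b k : nat) :
  rising (alpha + beta + 2 + (a + b)%:R) k * L (bern R (a + k) b) =
  rising (beta + 1 + a%:R) k * L (bern R a b).
Proof.
elim: k => [|k IHk]; first by rewrite /rising !big_ord0 addn0.
have h := jacobi_bernS (a + k) b.
have ck : alpha + beta + 2 + (a + b)%:R + k%:R =
          alpha + beta + 2 + (a + k + b)%:R.
  by rewrite !natrD; ring.
by rewrite !risingSr ck -mulrA addnS h mulrCA IHk natrD; ring.
Qed.

Definition endpoint_moment n j : R := L (bern R j.+1 (n - j)).

(** Up to a factor this is the Jacobi polynomial of degree n for the weight
(1-x)^alpha x^(beta+1), hence also D_0; dividing by the moments keeps Gamma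
functions out of its coefficients. *)
Definition endpoint_poly n : {poly R} :=
  \sum_(j < n.+1) ((-1) ^+ j / endpoint_moment n j) *: bernstein R n j.

(** In the j-th term the moment cancels against its denominator and leaves
(-1)^j 'C(n, j) times a rising factorial of length k in j. *)
Lemma endpoint_poly_monomial n k : (k < n)%N ->
  L (endpoint_poly n * ('X * 'X^k)) = 0.
Proof.
move=> ltkn.
rewrite /endpoint_poly mulr_suml raddf_sum /=.
have c0 : rising (alpha + beta + 3 + n%:R) k != 0.
  by rewrite gt_eqF // rising_gt0 //; have := ler0n R n; move: ha hb; lra.
apply: (mulfI c0); rewrite mulr0 mulr_sumr.
rewrite -[RHS](alternating_binomial_rising (beta + 2) ltkn).
apply: eq_bigr => j _.
have -> : ((-1) ^+ j / endpoint_moment n j) *: bernstein R n j * ('X * 'X^k) =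
  ((-1) ^+ j / endpoint_moment n j * 'C(n, j)%:R) *: bern R (j.+1 + k) (n - j).
  by rewrite bernsteinE /bern addSn !exprS exprD -!mul_polyC rmorphM /=; ring.
rewrite linearZ /= mulrCA.
have := jacobi_bern_rising j.+1 (n - j) k.
have jn : (j <= n)%N by rewrite -ltnS.
rewrite addSn subnKC // -[n.+1%:R]natr1 -[j.+1%:R]natr1 => h.
have -> : alpha + beta + 3 + n%:R = alpha + beta + 2 + (n%:R + 1) by ring.
rewrite h (_ : beta + 1 + (j%:R + 1) = beta + 2 + j%:R); last by ring.
rewrite -/(endpoint_moment n j).
by field; rewrite jacobi_bern_neq0.
Qed.

Lemma endpoint_poly_orth n (q : {poly R}) : (size q <= n)%N ->
  L (endpoint_poly n * ('X * q)) = 0.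
Proof.
move=> sq; rewrite -(coefK q) poly_def !mulr_sumr raddf_sum big1 //= => k _.
rewrite -!scalerAr linearZ /= endpoint_poly_monomial ?mulr0 //.
exact: leq_trans (ltn_ord k) sq.
Qed.

(** Pairing with the endpoint polynomial sees only the constant term, so it is
a multiple of evaluation at 0. *)
Lemma endpoint_poly_eval n (p : {poly R}) : (size p <= n.+1)%N ->
  L (endpoint_poly n * p) = p.[0] * L (endpoint_poly n).
Proof.
move=> /size_split0[q sq {1}->].
rewrite mulrDr linearD /= endpoint_poly_orth // addr0.
by rewrite mulrC mul_polyC linearZ.
Qed.

(** Expand the endpoint polynomial in the Bernstein basis and use duality on
one side, evaluation at 0 on the other. *)
Lemma dual_family_at0 n D j : dual_family L n D -> (j <= n)%N ->
  (D j).[0] * L (endpoint_poly n) = (-1) ^+ j / endpoint_moment n j.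
Proof.
move=> [szD dualD] jn; rewrite -endpoint_poly_eval ?szD //.
rewrite /endpoint_poly mulr_suml raddf_sum /=.
rewrite (bigD1 (Ordinal (jn : j < n.+1)%N)) //= big1 ?addr0.
  by rewrite -scalerAl linearZ /= dualD // eqxx mulr1.
move=> i ij; rewrite -scalerAl linearZ /= dualD //; last by rewrite -ltnS.
by rewrite -(inj_eq val_inj) /= in ij; rewrite (negPf ij) mulr0.
Qed.

(** The nonzero factor L(endpoint_poly n) cancels, and consecutive moments are
related by the beta recursion. *)
Lemma dual_family_rec0 n D j : dual_family L n D -> (j < n)%N ->
  (beta + j%:R + 2) * (D j.+1).[0] + (n%:R - j%:R + alpha) * (D j).[0] = 0.
Proof.
move=> dualD jn.
have e0 := dual_family_at0 dualD (ltnW jn).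
have e1 := dual_family_at0 dualD jn.
have g0 : L (endpoint_poly n) != 0.
  apply/eqP => g0; move: e0; rewrite g0 mulr0 => /esym/eqP.
  by rewrite mulf_eq0 signr_eq0 invr_eq0 (negPf (jacobi_bern_neq0 _ _)).
have m := jacobi_beta HL j.+1 (n - j.+1).
rewrite -subSn // subSS -/(endpoint_moment n j) -/(endpoint_moment n j.+1) in m.
have m0 : endpoint_moment n j != 0 := jacobi_bern_neq0 _ _.
have m1 : endpoint_moment n j.+1 != 0 := jacobi_bern_neq0 _ _.
apply: (mulIf g0); rewrite mul0r mulrDl -!mulrA e0 e1 exprS.
apply: (mulfI m0); apply: (mulfI m1); rewrite !mulr0.
move: m; rewrite natrB // -!natr1 => m.
transitivity ((-1) ^+ j * ((n%:R - j%:R + alpha) * endpoint_moment n j.+1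
                - (beta + j%:R + 2) * endpoint_moment n j)).
  by field; rewrite m0 m1.
rewrite (_ : _ - _ = 0) ?mulr0 //; apply/eqP; rewrite subr_eq0; apply/eqP.
rewrite (_ : beta + j%:R + 2 = beta + 1 + (j%:R + 1)); last by ring.
by rewrite m; ring.
Qed.
End Endpoint.

(** The substitution x -> 1-x exchanges the endpoints, alpha with beta and the
indices j with n-j, so results at 0 carry over to 1. *)
Definition reflect_functional (R : realType) (L : {scalar {poly R}}) :
  {scalar {poly R}} := L \o comp_poly (1 - 'X).

Lemma jacobi_functional_reflect (R : realType) (alpha beta : R)
    (L : {scalar {poly R}}) : jacobi_functional alpha beta L ->
  jacobi_functional beta alpha (reflect_functional L).
Proof.
move=> [Lbeta Ldef]; split=> [a b|p p0 Lp].
  by rewrite /= !reflect_bern -Lbeta.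
suff : p \Po (1 - 'X) = 0.
  by move/(congr1 (comp_poly (1 - 'X))); rewrite reflectK comp_poly0.
apply: Ldef Lp => x x01.
by rewrite horner_comp !hornerE p0 //; lra.
Qed.

Lemma dual_family_reflect (R : realType) (L : {scalar {poly R}}) (n : nat)
    (D : nat -> {poly R}) : dual_family L n D ->
  dual_family (reflect_functional L) n (fun j => D (n - j)%N \Po (1 - 'X)).
Proof.
move=> [szD dualD]; split=> [j jn|i j lein lejn].
  by rewrite size_reflect szD ?leq_subr.
rewrite /= comp_polyM reflectK bernsteinE comp_polyZ reflect_bern.
have := dualD (n - i)%N (n - j)%N (leq_subr _ _) (leq_subr _ _).
rewrite bernsteinE bin_sub // subKn // => ->.
rewrite -(eqn_add2r (i + j)) addnA subnK // (addnC i) addnA subnK //.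
by rewrite eqn_add2l eq_sym.
Qed.

(** * The recurrence for a functional of Jacobi type *)

Section Recurrence.
Variables (R : realType) (alpha beta : R) (L : {scalar {poly R}}).
Hypotheses (ha : -1 < alpha) (hb : -1 < beta).
Hypothesis HL : jacobi_functional alpha beta L.
Variables (n : nat) (D : nat -> {poly R}).
Hypothesis dualD : dual_family L n D.

Lemma dual_family_rec1 j : (j < n)%N ->
  (beta + j%:R + 1) * (D j.+1).[1] + (n%:R - j%:R + alpha + 1) * (D j).[1] = 0.
Proof.
move=> jn.
have jn' : (n - j.+1 < n)%N by rewrite ltn_subrL (leq_ltn_trans _ jn).
have := dual_family_rec0 hb ha (jacobi_functional_reflect HL)
  (dual_family_reflect dualD) jn'.
rewrite -subSn // subSS !subKn // 1?ltnW // natrB // -[j.+1%:R]natr1.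
have at0 (p : {poly R}) : (p \Po (1 - 'X)).[0] = p.[1].
  by rewrite horner_comp !hornerE subr0.
by rewrite !at0 => <-; ring.
Qed.

(** The coefficients are those for which the two contributions to
L(x^k (1-x)^(n-1-k) E_j), both supported at k = j, cancel. *)
Definition dual_pair j : {poly R} :=
  j.+1%:R *: (('X - 1) * D j) + (n%:R - j%:R) *: ('X * D j.+1).

Lemma dual_bern j k : (j <= n)%N -> (k <= n)%N ->
  'C(n, j)%:R * L (bern R j (n - j) * D k) = (j == k)%:R.
Proof.
by move=> jn kn; rewrite -(dualD.2 _ _ jn kn) bernsteinE -scalerAl linearZ.
Qed.

(** Multiplying the test polynomial by x-1 or x raises its total degree to n,
where duality applies; the two terms cancel because
(k+1) 'C(n, k+1) = (n-k) 'C(n, k). *)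
Lemma dual_pair_orth_bern j k : (j < n)%N -> (k < n)%N ->
  L (bern R k (n.-1 - k) * dual_pair j) = 0.
Proof.
move=> jn kn.
have -> : bern R k (n.-1 - k) * dual_pair j =
  - (j.+1%:R *: (bern R k (n - k) * D j))
  + (n%:R - j%:R) *: (bern R k.+1 (n - k.+1) * D j.+1).
  have nk : (n - k = (n.-1 - k).+1)%N by rewrite -subn1 -subnDA add1n subnSK.
  rewrite subnS nk /= /dual_pair /bern !exprS -!mul_polyC; ring.
have LZ c p : L (c *: p) = c * L p by rewrite linearZ.
rewrite linearD linearN !LZ.
have c0 : 'C(n, k)%:R != 0 :> R by rewrite pnatr_eq0 -lt0n bin_gt0 ltnW.
have c1 : 'C(n, k.+1)%:R != 0 :> R by rewrite pnatr_eq0 -lt0n bin_gt0.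
have e0 := dual_bern (ltnW kn) (ltnW jn).
have e1 := dual_bern kn jn.
have cc : k.+1%:R * 'C(n, k.+1)%:R = (n%:R - k%:R) * 'C(n, k)%:R :> R.
  have -> : n%:R - k%:R = (n - k)%:R :> R by rewrite natrB // ltnW.
  by rewrite -[LHS]natrM mul_bin_left natrM.
rewrite eqSS in e1.
apply: (mulfI c0); rewrite mulr0 mulrDr mulrN [_ * (j.+1%:R * _)]mulrCA e0.
apply: (mulfI c1); rewrite mulr0.
rewrite (_ : _ * _ = - (j.+1%:R * 'C(n, k.+1)%:R * (k == j)%:R) +
   (n%:R - j%:R) * 'C(n, k)%:R * (k == j)%:R); last by rewrite -e1; ring.
have [<-|_] := eqVneq k j; last by rewrite !mulr0 oppr0 addr0.
by rewrite cc; ring.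
Qed.

Lemma dual_pair_orth j (q : {poly R}) : (j < n)%N -> (size q <= n)%N ->
  L (q * dual_pair j) = 0.
Proof.
by move=> jn sq; apply: (orth_of_bern sq) => k kn; apply: dual_pair_orth_bern.
Qed.

Lemma size_dual_pair j : (j < n)%N -> (size (dual_pair j) <= n.+2)%N.
Proof.
move=> jn; have [szD _] := dualD.
have s1 : (size (('X - 1) * D j)%R <= n.+2)%N.
  by rewrite (leq_trans (size_polyMleq _ _)) // size_XsubC /= ltnS szD // ltnW.
have s2 : (size ('X * D j.+1)%R <= n.+2)%N.
  by rewrite (leq_trans (size_polyMleq _ _)) // size_polyX /= ltnS szD.
rewrite (leq_trans (size_polyD _ _)) // geq_max.
by rewrite !(leq_trans (size_scale_leq _ _)).
Qed.

(** Such a p is -x(1-x)q with deg q < n, and orthogonality to q itself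
contradicts definiteness unless q = 0. *)
Lemma orth_endpoints_eq0 (p : {poly R}) : (size p <= n.+2)%N ->
  (forall q : {poly R}, (size q <= n)%N -> L (q * p) = 0) ->
  p.[0] = 0 -> p.[1] = 0 -> p = 0.
Proof.
move=> sp orthp p0 p1.
have [r sr pE] := size_split0 sp.
rewrite p0 add0r in pE.
have /factor_theorem[q rE] : root r 1.
  by move: p1; rewrite pE !hornerE rootE => ->.
have sq : (size q <= n)%N.
  have [->|q0] := eqVneq q 0; first by rewrite size_poly0.
  by move: sr; rewrite rE size_Mmonic ?monicXsubC // size_XsubC addn2.
have : 'X * (1 - 'X) * q ^+ 2 = 0.
  apply: (jacobi_definite HL) => [x /andP[x0 x1]|].
    rewrite hornerM horner_exp mulr_ge0 ?sqr_ge0 // hornerM hornerX.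
    by rewrite !hornerE mulr_ge0 ?subr_ge0 // ltW.
  rewrite (_ : _ * _ = - (q * p)) ?linearN /= ?orthp ?oppr0 //.
  by rewrite pE rE; ring.
have x1 : 1 - 'X != 0 :> {poly R}.
  by rewrite -opprB oppr_eq0 polyXsubC_eq0.
move/eqP; rewrite 2!mulf_eq0 polyX_eq0 (negPf x1) expf_eq0 /= => /eqP q0.
by rewrite pE rE q0 mul0r mulr0.
Qed.

Lemma dual_pair_at0 j : (dual_pair j).[0] = - (j.+1%:R * (D j).[0]).
Proof.
rewrite /dual_pair hornerD !hornerZ !hornerM.
by rewrite !(hornerD, hornerN, hornerX, hornerC); ring.
Qed.

Lemma dual_pair_at1 j : (dual_pair j).[1] = (n%:R - j%:R) * (D j.+1).[1].
Proof.
rewrite /dual_pair hornerD !hornerZ !hornerM.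
by rewrite !(hornerD, hornerN, hornerX, hornerC); ring.
Qed.

(** The left-hand side is a combination of E_i, E_{i+1} and E_{i+2}, which
gives its degree and its orthogonality; at each endpoint its value is a
combination of two instances of the two-term recurrence there. *)
Lemma dual_recurrence i : (i + 3 <= n)%N ->
  w0 n alpha i * D i + w1 n alpha beta i * D i.+1
    + w2 n alpha beta i * D i.+2 + w3 n beta i * D i.+3 = 0.
Proof.
rewrite addnC => i3.
have i1 : (i < n)%N by apply: leq_trans i3; rewrite ltnS leqW.
have i2 : (i.+1 < n)%N by apply: leq_trans i3; rewrite !ltnS.
pose N : R := n%:R - i%:R + alpha.
pose b : R := i%:R + beta + 2.
pose c0 := N * (N - 1); pose c1 := 2 * (N - 1) * b; pose c2 := b * (b + 1).
have -> : w0 n alpha i * D i + w1 n alpha beta i * D i.+1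
    + w2 n alpha beta i * D i.+2 + w3 n beta i * D i.+3 =
    c0 *: dual_pair i + c1 *: dual_pair i.+1 + c2 *: dual_pair i.+2.
  rewrite /w0 /w1 /w2 /w3 /dual_pair /poch2 /c0 /c1 /c2 /N /b.
  rewrite -[i.+3%:R]natr1 -[i.+2%:R]natr1 -[i.+1%:R]natr1 -!mul_polyC.
  by ring.
apply: orth_endpoints_eq0.
- have sz c j : (j < n)%N -> (size (c *: dual_pair j) <= n.+2)%N.
    by move=> jn; rewrite (leq_trans (size_scale_leq _ _)) ?size_dual_pair.
  rewrite (leq_trans (size_polyD _ _)) // geq_max sz // andbT.
  by rewrite (leq_trans (size_polyD _ _)) // geq_max !sz.
- have orth c j (q : {poly R}) : (j < n)%N -> (size q <= n)%N ->
      L (q * (c *: dual_pair j)) = 0.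
    by move=> jn sq; rewrite -scalerAr linearZ /= dual_pair_orth ?mulr0.
  have LD p1 p2 : L (p1 + p2) = L p1 + L p2 by rewrite linearD.
  by move=> q sq; rewrite !mulrDr !LD !orth // !addr0.
- have := dual_family_rec0 ha hb HL dualD i1.
  have := dual_family_rec0 ha hb HL dualD i2.
  (* E_j(0) = -(j+1) D_j(0), so P(0) is -(i+1)(N-1) times the recurrence at i
     minus (i+3) b times the one at i+1 *)
  rewrite 2!hornerD 3!hornerZ !dual_pair_at0.
  rewrite -[i.+3%:R]natr1 -[i.+2%:R]natr1 -[i.+1%:R]natr1 /c0 /c1 /c2 /N /b.
  move: (D i).[0] (D i.+1).[0] (D i.+2).[0] => x y z h1 h2.
  transitivity (- (i%:R + 1) * (N - 1) * 0 - (i%:R + 3) * b * 0); last by ring.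
  by rewrite -{1}h2 -{1}h1 /N /b; ring.
- have := dual_family_rec1 i2.
  have := dual_family_rec1 i3.
  (* E_j(1) = (n-j) D_{j+1}(1), so P(1) is (n-i)(N-1) times the recurrence at
     i+1 plus (n-i-2) b times the one at i+2 *)
  rewrite 2!hornerD 3!hornerZ !dual_pair_at1.
  rewrite -[i.+2%:R]natr1 -[i.+1%:R]natr1 /c0 /c1 /c2 /N /b.
  move: (D i.+1).[1] (D i.+2).[1] (D i.+3).[1] => x y z h1 h2.
  transitivity ((n%:R - i%:R) * (N - 1) * 0 + (n%:R - i%:R - 2) * b * 0);
    last by ring.
  by rewrite -{1}h2 -{1}h1 /N /b; ring.
Qed.

End Recurrence.

(** * Integrals over an open interval *)

Import numFieldNormedType.Exports.
Local Open Scope classical_set_scope.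
Local Open Scope ring_scope.

(** Only the primitive has to extend continuously to the endpoints: apply the
theorem for continuous functions on closed subintervals exhausting ]a, b[ and
pass to the limit by monotone convergence. *)
Lemma ge0_FTC_oo (R : realType) (F f : R -> R) (a b : R) : a < b ->
  {in `]a, b[, continuous f} ->
  (forall x, x \in `]a, b[ -> is_derive x 1 F (f x)) ->
  F x @[x --> a^'+] --> F a -> F x @[x --> b^'-] --> F b ->
  (forall x, x \in `]a, b[ -> 0 <= f x) ->
  (\int[@lebesgue_measure R]_(x in `]a, b[) (f x)%:E = (F b - F a)%:E)%E.
Proof.
move=> ab cf dF Fa Fb f0.
(* the factor 1/3 keeps every interval of the exhaustion nondegenerate *)
pose d (n : nat) : R := (b - a) / 3 * harmonic n.
have k0 : 0 < (b - a) / 3 by rewrite divr_gt0 ?subr_gt0.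
have d0 n : 0 < d n by rewrite mulr_gt0 // harmonic_gt0.
have dS n : d n.+1 <= d n.
  by rewrite ler_pM2l // lef_pV2 ?posrE ?ltr0n // ler_nat.
have dle n : d n <= (b - a) / 3.
  by rewrite ger_pMr // invf_le1 ?ltr0n // ler1n.
have dcvg : d n @[n --> \oo] --> 0.
  rewrite -(mulr0 ((b - a) / 3)).
  by apply: cvgM; [exact: cvg_cst|exact: cvg_harmonic].
pose I n := `[a + d n, b - d n]%classic.
have Isub n : I n `<=` `]a, b[.
  move=> x; rewrite /I /= !in_itv /= => /andP[x1 x2].
  by have dn := d0 n; apply/andP; split; lra.
have IE : \bigcup_n I n = `]a, b[%classic.
  apply/seteqP; split => [x [n _]|x]; first exact: Isub.
  rewrite /= in_itv /= => /andP[ax xb].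
  have m0 : 0 < Num.min (x - a) (b - x) by rewrite lt_min !subr_gt0 ax.
  have [n _ Hn] := cvgr0_norm_lt _ dcvg _ m0.
  exists n => //; rewrite /I /= in_itv /=.
  have := Hn n (leqnn _); rewrite /= gtr0_norm ?d0 // lt_min => /andP[h1 h2].
  by apply/andP; split; lra.
have FTCn n : (\int[@lebesgue_measure R]_(x in I n) (f x)%:E
    = (F (b - d n))%:E - (F (a + d n))%:E)%E.
  have lt : a + d n < b - d n by have := dle n; lra.
  have sub x : x \in `[a + d n, b - d n] -> x \in `]a, b[.
    by move=> xI; have := Isub n x xI.
  have sub' x : x \in `]a + d n, b - d n[ -> x \in `]a, b[.
    by move=> /subset_itv_oo_cc /sub.
  apply: continuous_FTC2 => //.
  - apply: continuous_in_subspaceT => x /set_mem xI.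
    exact: cf x (Isub n x xI).
  - have cF x : x \in `]a, b[ -> F y @[y --> x] --> F x.
      by move=> /dF [dx _]; apply/differentiable_continuous/derivable1_diffP.
    split => [x /sub' /dF []//||].
    + apply: cvg_at_right_filter; apply: cF; apply: sub.
      by rewrite in_itv /= lexx ltW.
    + apply: cvg_at_left_filter; apply: cF; apply: sub.
      by rewrite in_itv /= lexx ltW.
  - by move=> x /sub' /dF [_ <-]; rewrite derive1E.
apply/esym.
suff : ((fun n => \int[@lebesgue_measure R]_(x in I n) (f x)%:E) @ \oo
    --> (F b - F a)%:E)%E.
  move=> h.
  have mf : measurable_fun `]a, b[ f.
    apply: open_continuous_measurable_fun => //.
    by move=> x /set_mem; apply: cf.
  have : ((fun n => \int[@lebesgue_measure R]_(x in I n) (f x)%:E) @ \oo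
      --> \int[@lebesgue_measure R]_(x in \bigcup_n I n) (f x)%:E)%E.
    apply: ge0_nondecreasing_set_cvg_integral => //.
    - apply/nondecreasing_seqP => n; apply/subsetPset => x.
      rewrite /I /= !in_itv /= => /andP[h1 h2].
      by have dn := dS n; apply/andP; split; lra.
    - by move=> n; exact: measurable_itv.
    - move=> n; apply/measurable_EFinP.
      by apply: measurable_funS mf => //; exact: Isub.
    - by move=> n x /Isub xab; rewrite lee_fin f0.
  by rewrite IE; apply: cvg_unique.
under eq_cvg do rewrite FTCn -EFinB.
apply: cvg_EFin; first exact: nearW.
apply: cvgB.
- have /cvg_at_leftP := Fb; apply; split => [n|].
    by rewrite ltrBlDr ltrDl.
  by rewrite -[X in _ --> X]subr0; apply: cvgB => //; exact: cvg_cst.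
- have /cvg_at_rightP := Fa; apply; split => [n|].
    by rewrite ltrDl.
  by rewrite -[X in _ --> X]addr0; apply: cvgD => //; exact: cvg_cst.
Qed.

(** * The Jacobi weight *)

Lemma cvg_onem_powR0 (R : realType) (c : R) : 0 < c ->
  (1 - x) `^ c @[x --> 1^'-] --> 0.
Proof.
move=> c0; apply/cvg_at_leftP => u [u1 ucvg].
have /cvg_at_rightP := powR_cvg0 c0; apply; split => [n|].
  by rewrite subr_gt0.
rewrite -[X in _ --> X](subrr 1); apply: cvgB => //; exact: cvg_cst.
Qed.

Lemma is_derive_powRS (R : realType) (c x : R) : 0 < x ->
  is_derive x 1 (fun y => y `^ (c + 1)) ((c + 1) * x `^ c).
Proof. by move=> /(is_derive1_powR (c + 1)); rewrite addrK. Qed.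

Lemma is_derive_onem_powRS (R : realType) (c x : R) : x < 1 ->
  is_derive x 1 (fun y => (1 - y) `^ (c + 1)) (- ((c + 1) * (1 - x) `^ c)).
Proof.
rewrite -subr_gt0 => /(is_derive_powRS c) d.
have d' : is_derive x 1 (fun y : R => 1 - y) (-1).
  by rewrite -[X in is_derive _ _ _ X]add0r; apply: is_deriveB.
have := @is_derive1_comp _ (fun y => y `^ (c + 1)) (fun y => 1 - y) x _ _ d d'.
by rewrite mulrN1.
Qed.

Lemma derivable_cvg_pt (R : realType) (F : R -> R) (x l : R) :
  is_derive x 1 F l -> F y @[y --> x] --> F x.
Proof. by move=> [dx _]; apply/differentiable_continuous/derivable1_diffP. Qed.

Lemma cvg_powRS0 (R : realType) (c : R) : -1 < c ->
  x `^ (c + 1) @[x --> (0 : R)^'+] --> (0 : R) `^ (c + 1).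
Proof.
move=> c1; have c0 : 0 < c + 1 by lra.
by rewrite powR0 ?gt_eqF //; exact: powR_cvg0.
Qed.

Lemma cvg_onem_powRS1 (R : realType) (c : R) : -1 < c ->
  (1 - x) `^ (c + 1) @[x --> (1 : R)^'-] --> (1 - 1 : R) `^ (c + 1).
Proof.
move=> c1; have c0 : 0 < c + 1 by lra.
by rewrite subrr powR0 ?gt_eqF //; exact: cvg_onem_powR0.
Qed.

Definition weight (R : realType) (alpha beta x : R) : R :=
  (1 - x) `^ alpha * x `^ beta.

Lemma weight_continuous (R : realType) (alpha beta : R) :
  {in `]0, 1[, continuous (weight alpha beta)}.
Proof.
move=> x; rewrite in_itv /= => /andP[x0 x1].
have := is_derive_powRS (beta - 1) x0; rewrite subrK => /derivable_cvg_pt cx.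
have := is_derive_onem_powRS (alpha - 1) x1; rewrite subrK.
move=> /derivable_cvg_pt c1.
exact: cvgM c1 cx.
Qed.

Lemma weight_ge0 (R : realType) (alpha beta x : R) : 0 <= weight alpha beta x.
Proof. by rewrite mulr_ge0 ?powR_ge0. Qed.

Lemma measurable_weight (R : realType) (alpha beta : R) :
  measurable_fun `](0 : R), (1 : R)[ (weight alpha beta).
Proof.
apply: open_continuous_measurable_fun => //.
by move=> x /set_mem; apply: weight_continuous.
Qed.

Section WeightIntegral.
Variables (R : realType) (alpha beta : R).
Hypotheses (ha : -1 < alpha) (hb : -1 < beta).
Let mu := @lebesgue_measure R.

Lemma integrable_of_integral (f : R -> R) (l : R) :
  measurable_fun `](0 : R), (1 : R)[ f ->
  (forall x, x \in `]0, 1[ -> 0 <= f x) ->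
  (\int[mu]_(x in `]0%R, 1%R[) (f x)%:E = l%:E)%E ->
  mu.-integrable `](0 : R), (1 : R)[ (EFin \o f).
Proof.
move=> mf f0 fl; apply/integrableP; split; first exact/measurable_EFinP.
rewrite (_ : (\int[mu]_(x in _) _)%E = l%:E) ?ltry // -fl.
by apply: eq_integral => x /set_mem x01; rewrite /= ger0_norm ?f0.
Qed.

Lemma weight_alpha0E x : weight alpha 0 x = (1 - x) `^ alpha.
Proof. by rewrite /weight powRr0 mulr1. Qed.

Lemma weight_0betaE x : weight 0 beta x = x `^ beta.
Proof. by rewrite /weight powRr0 mul1r. Qed.

Lemma integral_weight_0beta :
  (\int[mu]_(x in `]0%R, 1%R[) ((beta + 1) * weight 0 beta x)%:E = 1%:E)%E.
Proof.
have b1 : 0 < beta + 1 by move: hb; lra.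
have -> : (1%:E = (1 `^ (beta + 1) - 0 `^ (beta + 1))%:E :> \bar R)%E.
  by rewrite powR1 powR0 ?gt_eqF // subr0.
apply: (@ge0_FTC_oo _ (fun x => x `^ (beta + 1))) => //.
- move=> x x01; apply: cvgM; first exact: cvg_cst.
  exact: weight_continuous.
- move=> x; rewrite in_itv /= => /andP[x0 _]; rewrite weight_0betaE.
  exact: is_derive_powRS.
- exact: cvg_powRS0.
- exact/cvg_at_left_filter/(derivable_cvg_pt (is_derive_powRS beta ltr01)).
- by move=> x _; rewrite mulr_ge0 ?weight_ge0 // ltW.
Qed.

Lemma integral_weight_alpha0 :
  (\int[mu]_(x in `]0%R, 1%R[) ((alpha + 1) * weight alpha 0 x)%:E = 1%:E)%E.
Proof.
have a1 : 0 < alpha + 1 by move: ha; lra.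
have -> : (1%:E = (- (1 - 1) `^ (alpha + 1) - - (1 - 0) `^ (alpha + 1))%:E
    :> \bar R)%E.
  by rewrite subrr subr0 powR1 powR0 ?gt_eqF // oppr0 opprK add0r.
apply: (@ge0_FTC_oo _ (fun x => - (1 - x) `^ (alpha + 1))) => //.
- move=> x x01; apply: cvgM; first exact: cvg_cst.
  exact: weight_continuous.
- move=> x; rewrite in_itv /= => /andP[_ x1]; rewrite weight_alpha0E.
  by have := is_deriveN (is_derive_onem_powRS alpha x1); rewrite opprK.
- apply: cvgN; apply: cvg_at_right_filter.
  exact: derivable_cvg_pt (is_derive_onem_powRS alpha ltr01).
- by apply: cvgN; exact: cvg_onem_powRS1.
- by move=> x _; rewrite mulr_ge0 ?weight_ge0 // ltW.
Qed.

Lemma integrableZ_oo01 (k : R) (f : R -> R) :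
  mu.-integrable `](0 : R), (1 : R)[ (EFin \o f) ->
  mu.-integrable `](0 : R), (1 : R)[ (EFin \o (fun x => k * f x)).
Proof.
move=> fi.
have : mu.-integrable `](0 : R), (1 : R)[ (fun x => k%:E * (EFin \o f) x)%E.
  exact: integrableZl.
exact: eq_integrable.
Qed.

Lemma integrable_weight_alpha0 :
  mu.-integrable `](0 : R), (1 : R)[ (EFin \o weight alpha 0).
Proof.
have a1 : 0 < alpha + 1 by move: ha; lra.
have : mu.-integrable `](0 : R), (1 : R)[
    (EFin \o (fun x => (alpha + 1)^-1 * ((alpha + 1) * weight alpha 0 x))).
  apply/integrableZ_oo01/(integrable_of_integral _ _ integral_weight_alpha0).
    by apply: measurable_funM => //; exact: measurable_weight.
  by move=> x _; rewrite mulr_ge0 ?weight_ge0 // ltW.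
by apply: eq_integrable => // x _; rewrite /= mulKf // gt_eqF.
Qed.

Lemma integrable_weight_0beta :
  mu.-integrable `](0 : R), (1 : R)[ (EFin \o weight 0 beta).
Proof.
have b1 : 0 < beta + 1 by move: hb; lra.
have : mu.-integrable `](0 : R), (1 : R)[
    (EFin \o (fun x => (beta + 1)^-1 * ((beta + 1) * weight 0 beta x))).
  apply/integrableZ_oo01/(integrable_of_integral _ _ integral_weight_0beta).
    by apply: measurable_funM => //; exact: measurable_weight.
  by move=> x _; rewrite mulr_ge0 ?weight_ge0 // ltW.
by apply: eq_integrable => // x _; rewrite /= mulKf // gt_eqF.
Qed.

Lemma weight_sucl x : x < 1 ->
  weight (alpha + 1) beta x = (1 - x) * weight alpha beta x.
Proof.
move=> x1; have x1' : 1 - x != 0 by rewrite subr_eq0 gt_eqF.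
by rewrite /weight powRD ?x1' ?implybT // powRr1 ?subr_ge0 1?ltW //; ring.
Qed.

Lemma weight_sucr x : 0 < x ->
  weight alpha (beta + 1) x = x * weight alpha beta x.
Proof.
move=> x0; have x0' : x != 0 by rewrite gt_eqF.
by rewrite /weight powRD ?x0' ?implybT // powRr1 1?ltW //; ring.
Qed.

Lemma powRS_le1 (c x : R) : -1 < c -> 0 < x < 1 -> x `^ (c + 1) <= 1.
Proof.
move=> c1 /andP[x0 x1].
have c0 : 0 <= c + 1 by lra.
have := ge0_ler_powR c0 (ltW x0) ler01 (ltW x1).
by rewrite powR1.
Qed.

(** Since 1 = x + (1-x), the weight is the sum of those for (alpha, beta+1) and
(alpha+1, beta), which are bounded by (1-x)^alpha and x^beta. *)
Lemma integrable_weight :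
  mu.-integrable `](0 : R), (1 : R)[ (EFin \o weight alpha beta).
Proof.
apply: le_integrable
  (integrableD _ integrable_weight_alpha0 integrable_weight_0beta) => //.
  by apply/measurable_EFinP; exact: measurable_weight.
move=> x; rewrite /= in_itv /= => /andP[x0 x1].
rewrite lee_fin !ger0_norm ?addr_ge0 ?weight_ge0 //.
rewrite (_ : weight alpha beta x =
             weight alpha (beta + 1) x + weight (alpha + 1) beta x).
  rewrite lerD // /weight powRr0.
    by rewrite ler_wpM2l ?powR_ge0 // powRS_le1 ?x0.
  by rewrite ler_wpM2r ?powR_ge0 // powRS_le1 //; lra.
by rewrite weight_sucl // weight_sucr //; ring.
Qed.

End WeightIntegral.

Definition beta_integral (R : realType) (alpha beta : R) : R :=
  \int[@lebesgue_measure R]_(x in `]0%R, 1%R[) weight alpha beta x.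

(** Integrate the derivative of (1-x)^(alpha+1) x^(beta+1), which vanishes at
both endpoints.  It changes sign, so (alpha+1) (1-x)^alpha is added to make it
nonnegative; the integral of that term is 1. *)
Lemma beta_integral_rec (R : realType) (alpha beta : R) :
  -1 < alpha -> -1 < beta ->
  (beta + 1) * beta_integral (alpha + 1) beta =
  (alpha + 1) * beta_integral alpha (beta + 1).
Proof.
move=> ha hb.
have ha1 : -1 < alpha + 1 by lra.
have hb1 : -1 < beta + 1 by lra.
have i1 := integrable_weight ha1 hb.
have i2 := integrable_weight ha hb1.
have i3 := integrable_weight_alpha0 ha.
pose F x : R :=
  (1 - x) `^ (alpha + 1) * x `^ (beta + 1) - (1 - x) `^ (alpha + 1).
pose f x : R := ((beta + 1) * weight (alpha + 1) beta x
  - (alpha + 1) * weight alpha (beta + 1) x) + (alpha + 1) * weight alpha 0 x.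
have If : (\int[@lebesgue_measure R]_(x in `]0%R, 1%R[) (f x)%:E
    = (F 1 - F 0)%:E)%E.
  apply: ge0_FTC_oo => //.
  - move=> x x01; apply: cvgD; first apply: cvgB.
    + by apply: cvgM; [exact: cvg_cst|exact: weight_continuous].
    + by apply: cvgM; [exact: cvg_cst|exact: weight_continuous].
    + by apply: cvgM; [exact: cvg_cst|exact: weight_continuous].
  - move=> x; rewrite in_itv /= => /andP[x0 x1].
    have d1 := is_derive_onem_powRS alpha x1.
    have d0 := is_derive_powRS beta x0.
    apply: (is_derive_eq (is_deriveB (is_deriveM d1 d0) d1)).
    by rewrite /f /weight powRr0 !/GRing.scale /=; ring.
  - have x01 : 0 < 1 :> R := ltr01.
    have c1 := derivable_cvg_pt (is_derive_onem_powRS alpha x01).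
    apply: cvgB; last exact: cvg_at_right_filter.
    by apply: cvgM; [exact: cvg_at_right_filter|exact: cvg_powRS0].
  - have c0 := derivable_cvg_pt (is_derive_powRS beta (ltr01 : 0 < 1 :> R)).
    apply: cvgB; last exact: cvg_onem_powRS1.
    by apply: cvgM; [exact: cvg_onem_powRS1|exact: cvg_at_left_filter].
  - move=> x; rewrite in_itv /= => /andP[x0 x1].
    rewrite /f -addrA addr_ge0 //.
      by rewrite mulr_ge0 ?weight_ge0 //; lra.
    rewrite addrC -mulrBr mulr_ge0 //; first by lra.
    rewrite /weight powRr0 -mulrBr mulr_ge0 ?powR_ge0 // subr_ge0.
    by rewrite powRS_le1 ?x0.
have I3 : (alpha + 1) * beta_integral alpha 0 = 1.
  rewrite -RintegralZl //.
  by rewrite /Rintegral integral_weight_alpha0.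
have F01 : F 1 - F 0 = 1.
  have h0 : 0 `^ (alpha + 1) = 0 :> R by rewrite powR0 // gt_eqF; lra.
  have h1 : 0 `^ (beta + 1) = 0 :> R by rewrite powR0 // gt_eqF; lra.
  by rewrite /F subrr subr0 h0 h1 powR1; ring.
have : \int[@lebesgue_measure R]_(x in `]0%R, 1%R[) f x = 1.
  by rewrite /Rintegral If F01.
have i12 : (@lebesgue_measure R).-integrable `](0 : R), (1 : R)[
    (EFin \o (fun x => (beta + 1) * weight (alpha + 1) beta x
                     - (alpha + 1) * weight alpha (beta + 1) x)).
  have := integrableB _ (integrableZ_oo01 (beta + 1) i1)
                        (integrableZ_oo01 (alpha + 1) i2).
  by move=> /(_ (measurable_itv _)); apply: eq_integrable.
rewrite RintegralD ?RintegralB ?RintegralZl //; try exact: integrableZ_oo01.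
rewrite -!/(beta_integral _ _) I3 => h.
by apply/eqP; rewrite -subr_eq0; apply/eqP/(addIr 1); rewrite add0r.
Qed.

(** * The weighted integral as a functional *)

Lemma horner_bounded01 (R : realType) (p : {poly R}) :
  exists2 C : R, 0 <= C & forall x, 0 < x < 1 -> `|p.[x]| <= C.
Proof.
exists (\sum_(i < size p) `|p`_i|) => [|x /andP[x0 x1]].
  by apply: sumr_ge0 => i _; apply: normr_ge0.
rewrite horner_coef (le_trans (ler_norm_sum _ _ _)) // ler_sum // => i _.
by rewrite normrM ler_piMr // normrX gtr0_norm // exprn_ile1 // ltW.
Qed.

Lemma finite_root (R : realType) (p : {poly R}) :
  p != 0 -> finite_set [set x | root p x].
Proof.
move=> p0; apply: contrapT => /(@infinite_set_fset _ _ (size p))[B Bp].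
apply/negP; rewrite -ltnNge; apply: max_poly_roots => //.
  by apply/allP => x xB; exact: Bp.
exact: finmap.fset_uniq.
Qed.

Section JacobiFunctional.
Variables (R : realType) (alpha beta : R).
Hypotheses (ha : -1 < alpha) (hb : -1 < beta).
Let mu := @lebesgue_measure R.

Definition jacobi_integral (p : {poly R}) : R :=
  \int[mu]_(x in `]0%R, 1%R[) (weight alpha beta x * p.[x]).

Lemma measurable_weight_horner (p : {poly R}) :
  measurable_fun `](0 : R), (1 : R)[ (fun x => weight alpha beta x * p.[x]).
Proof.
apply: measurable_funM; first exact: measurable_weight.
apply: measurable_funTS; apply: continuous_measurable_fun.
exact: continuous_horner.
Qed.

Lemma integrable_weight_horner (p : {poly R}) :
  mu.-integrable `](0 : R), (1 : R)[
    (EFin \o (fun x => weight alpha beta x * p.[x])).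
Proof.
have [C C0 pC] := horner_bounded01 p.
apply: le_integrable (integrableZ_oo01 C (integrable_weight ha hb)) => //.
  by apply/measurable_EFinP; exact: measurable_weight_horner.
move=> x; rewrite /= in_itv /= => x01.
rewrite lee_fin !normrM (ger0_norm C0) mulrC ler_wpM2r //.
exact: pC.
Qed.

Lemma jacobi_integral_linear : scalar jacobi_integral.
Proof.
move=> a p q; rewrite /jacobi_integral.
have ip := integrable_weight_horner p.
rewrite -RintegralZl // -RintegralD //; last exact: integrable_weight_horner.
  by apply: eq_Rintegral => x _; rewrite hornerD hornerZ; ring.
exact: integrableZ_oo01.
Qed.

Definition jacobi_scalar : {scalar {poly R}} :=
  HB.pack_for {scalar {poly R}} jacobi_integral
    (GRing.isLinear.Build R {poly R} R *%R jacobi_integral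
       jacobi_integral_linear).

(** The integrands agree on ]0, 1[, and the endpoints form a null set. *)
Lemma jacobi_ipE (f g : {poly R}) :
  jacobi_ip alpha beta (horner f) (horner g) = jacobi_scalar (f * g).
Proof.
rewrite /jacobi_ip /= /jacobi_integral /Rintegral integral_itv_bndoo.
  by congr fine; apply: eq_integral => x _; rewrite hornerM mulrA.
apply/measurable_EFinP.
rewrite (_ : (fun x => _) = (fun x => weight alpha beta x * (f * g).[x])).
  exact: measurable_weight_horner.
by apply/funext => x; rewrite hornerM mulrA.
Qed.

Lemma jacobi_integral_bern (a b : nat) :
  jacobi_integral (bern R a b) = beta_integral (alpha + b%:R) (beta + a%:R).
Proof.
apply: eq_Rintegral => x /set_mem; rewrite /= in_itv /= => /andP[x0 x1].
have x1' : 0 < 1 - x by rewrite subr_gt0.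
have -> : (bern R a b).[x] = x ^+ a * (1 - x) ^+ b by rewrite !hornerE.
rewrite /weight !powRD ?(gt_eqF x0) ?(gt_eqF x1') ?implybT //.
by rewrite !powR_mulrn 1?ltW //; ring.
Qed.

(** A nonnegative integrand with zero integral vanishes almost everywhere; as
the weight has no zero in ]0, 1[, the finitely many roots of a nonzero p would
have to fill the interval up to a null set. *)
Lemma jacobi_integral_definite (p : {poly R}) :
  (forall x, 0 < x < 1 -> 0 <= p.[x]) -> jacobi_integral p = 0 -> p = 0.
Proof.
move=> p_ge0 Ip.
apply/eqP/negPn/negP => p0.
pose f := EFin \o (fun x => weight alpha beta x * p.[x]).
have If : (\int[mu]_(x in `]0%R, 1%R[) `|f x| = 0)%E.
  rewrite (_ : (\int[mu]_(x in _) _)%E = (\int[mu]_(x in `]0%R, 1%R[) f x)%E).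
    rewrite -[LHS]fineK; first by congr EFin.
    exact: integrable_fin_num (integrable_weight_horner p).
  apply: eq_integral => x /set_mem; rewrite /= in_itv /= => x01.
  by rewrite ger0_norm // mulr_ge0 ?weight_ge0 ?p_ge0.
have [N [mN N0 subN]] :
    ae_eq mu (`](0 : R), (1 : R)[%classic : set R) f (cst 0%E).
  apply/ae_eq_integral_abs => //.
  by apply/measurable_EFinP; exact: measurable_weight_horner.
have mu01 : mu `](0 : R), (1 : R)[ = 1%E.
  by rewrite /mu lebesgue_measure_itv /= lte_fin ltr01 oppr0 adde0.
have cZ := finite_set_countable (finite_root p0).
have measZ : measurable ([set x | root p x] : set (measurableTypeR R)).
  exact: countable_measurable cZ.
have : (mu `]0%R, 1%R[ <= mu (N `|` [set x | root p x]))%E.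
  apply: le_measure; rewrite ?inE //; first exact: measurableU.
  move=> x x01; have [px|npx] := boolP (root p x); [by right|left].
  apply: subN => /(_ x01) /eqP; rewrite eqe mulf_eq0 -rootE (negPf npx) orbF.
  move: x01; rewrite /= in_itv /= => /andP[x0 x1].
  by rewrite /weight mulf_eq0 !powR_eq0 (gt_eqF x0) subr_eq0 (gt_eqF x1).
have -> : mu (N `|` [set x | root p x]) = 0%E.
  apply: etrans N0; apply: measureU0 => //.
  exact: countable_lebesgue_measure0.
by rewrite mu01 lee_fin ler10.
Qed.
End JacobiFunctional.

Lemma jacobi_scalarP (R : realType) (alpha beta : R)
  (ha : -1 < alpha) (hb : -1 < beta) :
  jacobi_functional alpha beta (jacobi_scalar ha hb).
Proof.
split=> [a b|p]; last exact: jacobi_integral_definite.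
have a1 := ler0n R a; have b1 := ler0n R b.
rewrite /= !jacobi_integral_bern.
have -> : alpha + b.+1%:R = alpha + b%:R + 1 by rewrite -[b.+1%:R]natr1 addrA.
have -> : beta + a.+1%:R = beta + a%:R + 1 by rewrite -[a.+1%:R]natr1 addrA.
rewrite !(addrAC _ 1) beta_integral_rec //; lra.
Qed.

Theorem corollary2p4 (R : realType) (alpha beta : R) (n : nat)
    (D : nat -> {poly R}) (i : nat)
    (halpha : -1 < alpha) (hbeta : -1 < beta)
    (hD : is_dual_bernstein n alpha beta D) (hi : (i + 3 <= n)%N) :
  w0 n alpha i * D i + w1 n alpha beta i * D i.+1
    + w2 n alpha beta i * D i.+2 + w3 n beta i * D i.+3 = 0.
Proof.
apply: (dual_recurrence halpha hbeta (jacobi_scalarP halpha hbeta) _ hi).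
have [szD dualD] := hD; split=> // j k jn kn.
by rewrite -(dualD _ _ jn kn) jacobi_ipE.
Qed.
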